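(* Let $S\subset\mathbb{R}^n$ be a nonempty semi-algebraic set, $f\colon\mathbb{R}^n\to\mathbb{R}\cup\{\infty\}$ a semi-algebraic function such that $f_* := \inf_{x\in S} f(x)$ is finite, and $\psi\colon\mathbb{R}^n\to\mathbb{R}_+$ a semi-algebraic residual function for $S$. Assume that for any sequence of points $x_k$ in $\mathbb{R}^n$ with $\psi(x_k)\to0$ one has $[f_*-f(x_k)]_+\to0$. Then there exist constants $c_*>0$ and $\alpha\in(0,1]$ such that for all $c>c_*$, $$\inf_{x\in S} f(x) = \inf_{x\in\mathbb{R}^n}\big\{f(x)+c\,(1+[f(x)]^2)[\psi(x)]^\alpha\big\},$$ $$\mathrm{argmin}_S f(x) = \mathrm{argmin}_{\mathbb{R}^n}\big\{f(x)+c\,(1+[f(x)]^2)[\psi(x)]^\alpha\big\}.$$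
   Context: $\mathbb{R}_+ := [0,\infty)$ and $[r]_+ := \max\{r,0\}$. A subset of $\mathbb{R}^n$ is semi-algebraic if it is a finite union of sets each defined by finitely many polynomial equations and strict inequalities; a function $h\colon X\to\mathbb{R}\cup\{\infty\}$ is semi-algebraic if $\{(x,y)\in X\times\mathbb{R}\mid y=h(x)\}$ is semi-algebraic. A residual function of $S$ is a function $\psi\colon\mathbb{R}^n\to\mathbb{R}_+$ such that $\psi(x)=0$ if and only if $x\in S$. No continuity of $f$ or $\psi$ and no closedness of $S$ is assumed. At points where $f(x)=\infty$, $[f_*-f(x)]_+=0$ and the penalized expression equals $\infty$. $\mathrm{argmin}$ denotes the set of points of the indicated set at which the (finite) infimum is attained (possibly empty). *)

(* Defs.v *)
From HB Require Import structures.
From mathcomp Require Import all_boot all_order all_algebra.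
From mathcomp Require Import all_classical all_reals all_analysis.
(* Not imported: the notations of mpoly clash with those of analysis. *)
From mathcomp Require mpoly.

Set Implicit Arguments.
Unset Strict Implicit.
Unset Printing Implicit Defensive.

Import Order.TTheory GRing.Theory Num.Theory.
Import numFieldNormedType.Exports.

Local Open Scope classical_set_scope.
Local Open Scope ring_scope.

(* Each b in s encodes the piece cut out by p = 0 for p in b.1 and 0 < q for
   q in b.2; opposite strict inequalities are obtained by negating q. *)
Definition semialgebraic (R : realType) (n : nat) (A : set 'rV[R]_n) : Prop :=
  exists s : seq (seq (mpoly.mpoly n R) * seq (mpoly.mpoly n R)),
    A = [set x : 'rV[R]_n |
         has (fun b => all (fun p => mpoly.meval (x 0) p == 0) b.1
                    && all (fun q => 0 < mpoly.meval (x 0) q) b.2) s].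

(* The graph lies over the finite values of h only; a point (x, y) of
   R^n x R is encoded as a row vector of length n + 1. *)
Definition semialgebraic_fun (R : realType) (n : nat)
    (h : 'rV[R]_n -> \bar R) : Prop :=
  semialgebraic [set z : 'rV[R]_(n + 1) | (rsubmx z 0 0)%:E = h (lsubmx z)].

Definition residual_fun (R : realType) (n : nat) (S : set 'rV[R]_n)
    (psi : 'rV[R]_n -> R) : Prop :=
  (forall x, 0 <= psi x) /\ (forall x, psi x = 0 <-> S x).

Definition argmin (R : realType) (T : Type) (A : set T) (h : T -> \bar R) :
    set T :=
  [set x | [/\ A x, h x \is a fin_num & h x = ereal_inf (h @` A)]].

(* If f x = +oo this is +oo, also when psi x = 0, since +oo * 0 = 0 in \bar R.
   For 0 < alpha, 0 `^ alpha = 0. *)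
Definition penalized (R : realType) (T : Type) (f : T -> \bar R)
    (psi : T -> R) (c alpha : R) (x : T) : \bar R :=
  (f x + c%:E * (1 + f x ^+ 2) * (psi x `^ alpha)%:E)%E.

(* Main.v *)
Require Import Defs.
From HB Require Import structures.
From mathcomp Require Import all_boot all_order all_algebra.
From mathcomp Require Import all_classical all_reals all_analysis.
From mathcomp Require Import lra.
From mathcomp Require mpoly ordered_qelim qe_rcf.

Import Order.TTheory GRing.Theory Num.Theory.
Import numFieldNormedType.Exports.
Import ordered_qelim.

Local Open Scope classical_set_scope.
Local Open Scope ring_scope.

(** Write [a] for the infimum of [f] on [S]. Where [f x >= a] and [x] is outside
    [S], the penalized value obviously exceeds [a], so everything reduces to a
    Lojasiewicz-type estimate: whenever [f x = r < a],
      [a - r < c * (1 + r ^ 2) * psi x ^ alpha]     (lemma [gap_lt_penalty]).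
    On [S] the penalty vanishes and off [S] the penalized function is then
    [> a], which gives both the equality of infima and that of argmins.

    The estimate comes from the family of sets indexed by [u, v > 0],
      [D (u, v) :  some x has f x <= a - 1/u and psi x <= 1/v].
    By Tarski-Seidenberg, [D] is given by a quantifier-free formula in [u]
    and [v], that is, by the signs of finitely many bivariate polynomials.
    In the regime where [u] is large and [v] exceeds a sufficiently high power
    of [u], each such polynomial has constant sign, the one of its dominant
    monomial; hence so is the truth value of [D]
    ([decided_holds], [decided_gap_residual]).
    If [D] were true there, fixing [u] and letting [v] go to infinity would
    yield points with [psi] tending to 0 and [f] staying below [a - 1/u],
    against the hypothesis on sequences.  So [D] is false there: for some [N]
    and [u0], every [u >= u0] and every [x] with [f x <= a - 1/u] satisfy
    [psi x > u ^ (- N)]  ([residual_gt_power]).  Taking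
    [u = max (u0, 1 / (a - f x))] gives the estimate when [f x] is close to
    [a]; when it is far from [a], [psi x] is bounded below and the factor
    [1 + r ^ 2] absorbs the growth of [a - r]. *)

(** * Functions bounded away from zero along a filter *)

Section NonVanishing.
Context {R : realType} {T : Type} {F : set_system T} {FF : Filter F}.

(** The sign is constant as well; a mere eventual sign would not survive the
    inductive step [bounded_awayMD]. *)
Definition bounded_away (g : T -> R) : Prop :=
  exists2 d, 0 < d &
    (\forall t \near F, d <= g t) \/ (\forall t \near F, d <= - g t).

(** The inductive step for Horner evaluation: if [x] dominates every multiple of
    [1 + `|a|], then the leading part [q * x] outweighs [a]. *)
Lemma bounded_awayMD {q x a : T -> R} :
  (forall c, \forall t \near F, c * (1 + `|a t|) <= x t) ->
  bounded_away q -> bounded_away (fun t => q t * x t + a t).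
Proof.
move=> x_dom.
have pos_case q' a' : (forall t, `|a' t| = `|a t|) ->
    forall d, 0 < d -> (\forall t \near F, d <= q' t) ->
    \forall t \near F, 1 <= q' t * x t + a' t.
  move=> aE d d0 q_d; near=> t.
  have xt : d^-1 * (1 + `|a' t|) <= x t by rewrite aE; near: t; exact: x_dom.
  have qt : d <= q' t by near: t.
  have : 1 + `|a' t| <= q' t * x t.
    have x0 : 0 <= x t.
      by apply: le_trans xt; rewrite mulr_ge0 ?invr_ge0 ?addr_ge0// ltW.
    apply: le_trans (ler_wpM2r x0 qt).
    by rewrite -ler_pdivrMl.
  have := ler_norm (- a' t); rewrite normrN; lra.
move=> [d d0 [] q_d]; exists 1 => //; [left|right].
  exact: (pos_case q a _ d).
have := pos_case (fun t => - q t) (fun t => - a t) (fun t => normrN _) d d0 q_d.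
by apply: filterS => t; rewrite opprD mulNr.
Unshelve. all: by end_near. Qed.

Definition decided (P : pred T) : Prop :=
  (\forall t \near F, P t) \/ (\forall t \near F, ~~ P t).

Lemma decidedN {P : pred T} : decided P -> decided (fun t => ~~ P t).
Proof.
move=> [] P_dec; [right|left] => //.
by apply: filterS P_dec => t; rewrite negbK.
Qed.

Lemma decidedI {P Q : pred T} :
  decided P -> decided Q -> decided (fun t => P t && Q t).
Proof.
move=> [] P_dec [] Q_dec.
- by left; apply: filterS2 P_dec Q_dec => t -> ->.
- by right; apply: filterS Q_dec => t /negPf ->; rewrite andbF.
- by right; apply: filterS P_dec => t /negPf ->.
- by right; apply: filterS P_dec => t /negPf ->.
Qed.

Lemma bounded_away_gt0 {g : T -> R} :
  bounded_away g -> decided (fun t => 0 < g t).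
Proof.
move=> [d d0 [] g_d]; [left|right]; apply: filterS g_d => t.
  exact: lt_le_trans.
by move=> dg; rewrite -leNgt -oppr_ge0; apply: le_trans dg; exact: ltW.
Qed.

End NonVanishing.
Arguments bounded_away {R T} F g.
Arguments decided {T} F P.

(** * Bivariate polynomials in the regime of a dominating second variable *)

Section LexInfty.
Context {R : realType}.

(** The regime in which [u] is large and [v] is larger than a power of [u].  The
    exponent may depend on the property, so that finitely many properties can
    be combined and [v] eventually dominates any given polynomial in [u]. *)
Definition lex_pinfty : set_system (R * R) :=
  [set A | exists N : nat,
     \forall u \near +oo, forall v, u ^+ N <= v -> A (u, v)].

#[global] Instance lex_pinfty_filter : Filter lex_pinfty.
Proof.
split.
- by exists 0%N; apply: filterE.
- move=> A B [M A_M] [N B_N]; exists (M + N)%N; near=> u => v uv.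
  have u1 : 1 <= u by near: u; exact: nbhs_pinfty_ge.
  have Au : forall w, u ^+ M <= w -> A (u, w) by near: u.
  have Bu : forall w, u ^+ N <= w -> B (u, w) by near: u.
  by split; [apply: Au|apply: Bu]; apply: le_trans uv;
    rewrite ler_weXn2l// ?leq_addr ?leq_addl.
- move=> A B AB [N A_N]; exists N; apply: filterS A_N => u Au v /Au; exact: AB.
Unshelve. all: by end_near. Qed.

Lemma near_lexP (P : R * R -> Prop) : (\forall z \near lex_pinfty, P z) ->
  exists (N : nat) (u0 : R), 1 <= u0 /\
    forall u v, u0 <= u -> u ^+ N <= v -> P (u, v).
Proof.
move=> [N [M [_ P_u]]]; exists N, (Num.max 1 (M + 1)).
rewrite le_max lexx; split=> // u v; rewrite ge_max => /andP[_ Mu].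
by apply: P_u; lra.
Qed.

Lemma near_lex_fst (P : R -> Prop) :
  (\forall u \near +oo, P u) -> \forall z \near lex_pinfty, P z.1.
Proof. by move=> Pu; exists 0%N; apply: filterS Pu => u. Qed.

Lemma horner_le_expr (p : {poly R}) :
  exists N : nat, \forall u \near +oo, `|p.[u]| <= u ^+ N.
Proof.
elim/poly_ind: p => [|p c [N p_N]].
  by exists 0%N; apply: filterE => u; rewrite horner0 normr0.
exists N.+2; near=> u; rewrite hornerMXaddC.
have pu : `|p.[u]| <= u ^+ N by near: u.
have u2 : 2 <= u by near: u; exact: nbhs_pinfty_ge.
have uc : `|c| <= u by near: u; exact: nbhs_pinfty_ge.
have u0 : 0 <= u by lra.
have u1N : u <= u ^+ N.+1 by rewrite exprS ler_peMr// exprn_ege1//; lra.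
apply: (le_trans (ler_normD _ _)).
have pu' : `|p.[u] * u| <= u ^+ N.+1.
  by rewrite normrM (ger0_norm u0) exprSr ler_wpM2r.
have : 2 * u ^+ N.+1 <= u ^+ N.+2 by rewrite [leRHS]exprS ler_wpM2r// exprn_ge0.
lra.
Unshelve. all: by end_near. Qed.

Lemma horner_bounded_away (p : {poly R}) :
  p != 0 -> bounded_away +oo (fun u => p.[u]).
Proof.
elim/poly_ind: p => [|p c IHp]; first by rewrite eqxx.
have [-> | p_neq0 _] := eqVneq p 0.
  rewrite mul0r add0r polyC_eq0 => c_neq0; exists `|c|.
    by rewrite normr_gt0.
  by have [c0|c0] := ger0P c; [left|right];
    apply: filterE => u; rewrite hornerC.
rewrite (_ : (fun _ => _) = fun u => p.[u] * u + c); last first.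
  by apply/funext => u; rewrite hornerMXaddC.
apply: bounded_awayMD; last exact: IHp.
by move=> k; apply: nbhs_pinfty_ge; exact: num_real.
Qed.

(** Induction on the degree in [v]; the base case is a nonzero polynomial in [u]
    alone, and in the step [v] dominates the coefficients, which are polynomials
    in [u]. *)
Lemma horner2_bounded_away (P : {poly {poly R}}) :
  P != 0 -> bounded_away lex_pinfty (fun z => P.[z.2%:P].[z.1]).
Proof.
elim/poly_ind: P => [|P p IHP]; first by rewrite eqxx.
have [-> | P_neq0 _] := eqVneq P 0.
  rewrite mul0r add0r polyC_eq0 => /horner_bounded_away [d d0 p_d].
  by exists d => //; case: p_d => /near_lex_fst p_d; [left|right];
    apply: filterS p_d => z; rewrite hornerC.
rewrite (_ : (fun _ => _) =
    fun z : R * R => P.[z.2%:P].[z.1] * z.2 + p.[z.1]); last first.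
  by apply/funext => z; rewrite hornerMXaddC hornerD hornerM hornerC.
apply: bounded_awayMD; last exact: IHP.
move=> k; have [N p_N] := horner_le_expr p.
exists N.+1; near=> u => v /=; apply: le_trans.
have pu : `|p.[u]| <= u ^+ N by near: u.
have u1 : 1 <= u by near: u; exact: nbhs_pinfty_ge.
have uk : 2 * `|k| <= u by near: u; exact: nbhs_pinfty_ge.
have uN : 1 <= u ^+ N by rewrite exprn_ege1.
have : k * (1 + `|p.[u]|) <= `|k| * (1 + `|p.[u]|).
  by rewrite ler_wpM2r ?ler_norm// addr_ge0.
have : `|k| * (1 + `|p.[u]|) <= `|k| * (2 * u ^+ N) by rewrite ler_wpM2l//; lra.
have : 2 * `|k| * u ^+ N <= u ^+ N.+1 by rewrite exprS ler_wpM2r//; lra.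
lra.
Unshelve. all: by end_near. Qed.

End LexInfty.

(** * First-order formulas over the reals *)

Section Definability.
Context {R : realType}.

Lemma rterm_horner2 (t : GRing.term R) : GRing.rterm t ->
  exists P : {poly {poly R}},
    forall u v, GRing.eval [:: u; v] t = P.[v%:P].[u].
Proof.
elim: t => //=.
(* Variables beyond the two of the environment evaluate to the default 0. *)
- move=> [|[|i]] _; [exists ('X%:P)|exists 'X|exists 0] => u v /=.
  + by rewrite hornerC hornerX.
  + by rewrite hornerX hornerC.
  + by rewrite nth_nil !horner0.
- by move=> a _; exists a%:P%:P => u v; rewrite !hornerC.
- by move=> n _; exists n%:R => u v; rewrite -!polyC_natr !hornerC.
- move=> t1 IH1 t2 IH2 /andP[/IH1[P PE] /IH2[Q QE]]; exists (P + Q) => u v.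
  by rewrite PE QE !hornerD.
- by move=> t IH /IH[P PE]; exists (- P) => u v; rewrite PE !hornerN.
- by move=> t IH n /IH[P PE]; exists (P *+ n) => u v; rewrite PE !hornerMn.
- move=> t1 IH1 t2 IH2 /andP[/IH1[P PE] /IH2[Q QE]]; exists (P * Q) => u v.
  by rewrite PE QE !hornerM.
- by move=> t IH n /IH[P PE]; exists (P ^+ n) => u v; rewrite PE !horner_exp.
Qed.

Lemma decided_lt (s t : GRing.term R) : GRing.rterm s -> GRing.rterm t ->
  decided lex_pinfty
    (fun z => GRing.eval [:: z.1; z.2] s < GRing.eval [:: z.1; z.2] t).
Proof.
move=> /rterm_horner2[P PE] /rterm_horner2[Q QE].
rewrite (_ : (fun _ => _) = fun z : R * R => 0 < (Q - P).[z.2%:P].[z.1]).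
  have [->|QP] := eqVneq (Q - P) 0.
    by right; apply: filterE => z; rewrite !horner0 ltxx.
  exact/bounded_away_gt0/horner2_bounded_away.
by apply/funext => z; rewrite PE QE !hornerE subr_gt0.
Qed.

Lemma decided_qf (f : ord.formula R) : ord.qf_form f -> ord.rformula f ->
  decided lex_pinfty (fun z => ord.qf_eval [:: z.1; z.2] f).
Proof.
have le_dec (s t : GRing.term R) : GRing.rterm s -> GRing.rterm t ->
    decided lex_pinfty
      (fun z => GRing.eval [:: z.1; z.2] s <= GRing.eval [:: z.1; z.2] t).
  move=> rs rt; under eq_fun do rewrite leNgt.
  by apply: decidedN; exact: decided_lt.
elim: f => //=.
- by move=> [] _ _; [left|right]; apply: filterE.
- move=> s t _ /andP[rs rt]; under eq_fun do rewrite eq_le.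
  by apply: decidedI; apply: le_dec.
- by move=> s t _ /andP[]; exact: decided_lt.
- by move=> s t _ /andP[]; exact: le_dec.
- by move=> f IHf g IHg /andP[/IHf{}IHf /IHg{}IHg] /andP[/IHf ? /IHg ?];
    exact: decidedI.
- move=> f IHf g IHg /andP[/IHf{}IHf /IHg{}IHg].
  move=> /andP[/IHf/decidedN df /IHg/decidedN dg].
  by under eq_fun do rewrite -[_ || _]negbK negb_or; exact/decidedN/decidedI.
- move=> f IHf g IHg /andP[/IHf{}IHf /IHg{}IHg] /andP[/IHf df /IHg/decidedN dg].
  under eq_fun do rewrite -[_ ==> _]negbK negb_imply.
  exact/decidedN/decidedI.
- by move=> f IHf /IHf{}IHf /IHf; exact: decidedN.
Qed.

(** Quantifier elimination reduces to the quantifier-free case, in which the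
    truth value depends on the signs of finitely many polynomials. *)
Lemma decided_holds (f : ord.formula R) :
  (\forall z \near lex_pinfty, ord.holds [:: z.1; z.2] f) \/
  (\forall z \near lex_pinfty, ~ ord.holds [:: z.1; z.2] f).
Proof.
have /andP[qf rf] := ord.quantifier_elim_wf (@qe_rcf.wf_QE_wproj R)
  (ord.to_rform_rformula f).
have [f_dec|f_dec] := decided_qf _ qf rf; [left|right];
  apply: filterS f_dec => z.
  by move=> /qe_rcf.rcf_satP.
by move=> /negP nf /qe_rcf.rcf_satP.
Qed.

(** Assigning a value to the variable just past the end of an environment appends
    that value, so the witnesses of the block line up as one sequence [w]. *)
Lemma holds_foldr_Exists (f : ord.formula R) (m : nat) (e : seq R) :
  ord.holds e (foldr (@ord.Exists R) f (iota (size e) m)) <->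
  exists2 w, size w = m & ord.holds (e ++ w) f.
Proof.
elim: m e => [|m IHm] e /=.
  split=> [fe|[w /size0nil ->]]; last by rewrite cats0.
  by exists [::]; rewrite ?cats0.
have set_rcons x : set_nth 0 e (size e) x = rcons e x.
  by elim: e => //= y e ->.
split=> [[x]|[[//|x w] [sw] fw]].
  rewrite set_rcons -(size_rcons e x) => /IHm[w sw].
  by rewrite cat_rcons; exists (x :: w); rewrite //= sw.
exists x; rewrite set_rcons -(size_rcons e x); apply/IHm.
by exists w; rewrite // cat_rcons.
Qed.

Definition definable (A : seq R -> Prop) : Prop :=
  exists f : ord.formula R, forall e, ord.holds e f <-> A e.

Lemma definableI {A B : seq R -> Prop} :
  definable A -> definable B -> definable (fun e => A e /\ B e).
Proof.
by move=> [f fA] [g gB]; exists (ord.And f g) => e /=; rewrite fA gB.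
Qed.

Lemma definableU {A B : seq R -> Prop} :
  definable A -> definable B -> definable (fun e => A e \/ B e).
Proof.
by move=> [f fA] [g gB]; exists (ord.Or f g) => e /=; rewrite fA gB.
Qed.

Definition expressible (g : seq R -> R) : Prop :=
  exists t : GRing.term R, forall e, GRing.eval e t = g e.

(** The map [i] chooses which variables of the formula play the role of the
    coordinates; this lets two semi-algebraic sets share variables. *)
Lemma expressible_meval (n : nat) (i : 'I_n -> nat) (p : mpoly.mpoly n R) :
  expressible (fun e => mpoly.meval (fun k => e`_(i k)) p).
Proof.
elim/mpoly.mpolyind: p => [|c m p _ _ [t tE]].
  by exists (GRing.Const 0) => e; rewrite mpoly.meval0.
have [q qE] : expressible
    (fun e => \prod_(k < n) e`_(i k) ^+ mpoly.fun_of_multinom m k).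
  elim: (index_enum _) => [|k s [q qE]].
    by exists (GRing.Const 1) => e; rewrite big_nil.
  exists (GRing.Mul
    (GRing.Exp (GRing.Var _ (i k)) (mpoly.fun_of_multinom m k)) q) => e /=.
  by rewrite big_cons qE.
exists (GRing.Add (GRing.Mul (GRing.Const c) q) t) => e /=.
by rewrite mpoly.mevalD mpoly.mevalZ mpoly.mevalX qE tE.
Qed.

Lemma definable_semialgebraic (n : nat) (A : set 'rV[R]_n) (i : 'I_n -> nat) :
  semialgebraic A -> definable (fun e => A (\row_k e`_(i k))).
Proof.
move=> [s ->].
pose row (e : seq R) : 'rV_n := \row_k e`_(i k).
have all_def (P : R -> bool) ps :
    (forall t, definable (fun e => P (GRing.eval e t))) ->
    definable (fun e => all (fun p => P (mpoly.meval (row e 0) p)) ps).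
  move=> P_def; elim: ps => [|p ps IHps] /=; first by exists (ord.Bool true).
  have [t tE] := expressible_meval _ i p.
  have [f fE] := definableI (P_def t) IHps; exists f => e; rewrite fE tE.
  rewrite -(@mpoly.meval_eq _ _ (row e 0)); last by move=> k; rewrite mxE.
  by split=> /andP.
have eq0_def t : definable (fun e => GRing.eval e t == 0).
  by exists (ord.Equal t (GRing.Const 0)) => e; split=> /eqP.
have gt0_def t : definable (fun e => 0 < GRing.eval e t).
  by exists (ord.Lt (GRing.Const 0) t) => e.
elim: s => [|b s IHs] /=; first by exists (ord.Bool false).
have [f fE] := definableU (definableI (all_def (fun y => y == 0) b.1 eq0_def)
  (all_def (fun y => 0 < y) b.2 gt0_def)) IHs.
exists f => e; rewrite fE.
split=> [[/andP ->//|->]|/orP[/andP|]]; rewrite ?orbT//.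
  by left.
by right.
Qed.

(** The witnesses of [D] are the coordinates of [x] together with [f x] and
    [psi x]: variables 0 and 1 are [u] and [v], variables 2 to [n + 1] are [x],
    variable [n + 2] is [f x] and variable [n + 3] is [psi x]. *)
Lemma decided_gap_residual (n : nat) (f : 'rV[R]_n -> \bar R)
    (psi : 'rV[R]_n -> R) (a : R) :
  semialgebraic_fun f -> semialgebraic_fun (fun x => (psi x)%:E) ->
  let D (z : R * R) := exists x r,
    [/\ r%:E = f x, 1 <= z.1 * (a - r) & psi x * z.2 <= 1] in
  (\forall z \near lex_pinfty, D z) \/ (\forall z \near lex_pinfty, ~ D z).
Proof.
move=> f_sa psi_sa D.
pose i (k : 'I_(n + 1)) : nat := (2 + k)%N.
pose j (k : 'I_(n + 1)) : nat := if (k < n)%N then (2 + k)%N else (3 + n)%N.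
have f_def := definable_semialgebraic _ _ i f_sa.
have psi_def := definable_semialgebraic _ _ j psi_sa.
have fge_def : definable (fun e => 1 <= e`_0 * (a - e`_(2 + n)%N)).
  by exists (ord.Le (GRing.Const 1) (GRing.Mul (GRing.Var _ 0)
    (GRing.Add (GRing.Const a) (GRing.Opp (GRing.Var _ (2 + n)%N))))) => e.
have psile_def : definable (fun e => e`_(3 + n)%N * e`_1 <= 1).
  by exists (ord.Le (GRing.Mul (GRing.Var _ (3 + n)%N) (GRing.Var _ 1))
    (GRing.Const 1)) => e.
have [F FE] := definableI (definableI f_def psi_def)
  (definableI fge_def psile_def).
have DE z : ord.holds [:: z.1; z.2]
    (foldr (@ord.Exists R) F (iota (size [:: z.1; z.2]) n.+2)) <-> D z.
  rewrite holds_foldr_Exists; split=> [[w sw /FE[[/= fw psiw] [/= aw w1]]]|].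
    exists (\row_k w`_k), w`_n; split=> //.
      move: fw; rewrite !mxE /= /i /= addn0 => ->; congr f.
      by apply/rowP => k; rewrite !mxE.
    move: psiw; rewrite !mxE /j/= addn0 ltnn => -[psiw]; move: w1.
    rewrite psiw (_ : lsubmx _ = \row_k w`_k)//.
    by apply/rowP => k; rewrite !mxE /= ltn_ord.
  move=> [x [r [fx ar psi1]]].
  pose w := [seq x 0 k | k <- enum 'I_n] ++ [:: r; psi x].
  have sx : size [seq x 0 k | k <- enum 'I_n] = n.
    by rewrite size_map size_enum_ord.
  have wx (k : 'I_n) : w`_k = x 0 k.
    by rewrite nth_cat sx ltn_ord (nth_map k) ?size_enum_ord// nth_ord_enum.
  have wr : w`_n = r by rewrite nth_cat sx ltnn subnn.
  have ws : w`_n.+1 = psi x by rewrite nth_cat sx ltnNge leqnSn subSnn.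
  exists w; first by rewrite size_cat sx addn2.
  apply/FE; split; split=> /=; rewrite ?wr ?ws//.
    rewrite !mxE /= addn0 wr fx; congr f.
    by apply/rowP => k; rewrite !mxE /= wx.
  rewrite !mxE /j /= addn0 ltnn /= ws; congr (psi _)%:E.
  by apply/rowP => k; rewrite !mxE /= ltn_ord /= wx.
have [D_ev|D_ev] := decided_holds
  (foldr (@ord.Exists R) F (iota 2 n.+2)); [left|right];
  by apply: filterS D_ev => z; rewrite DE.
Qed.
End Definability.

(** * The Lojasiewicz-type estimate *)

(** The set [D] of [decided_gap_residual] is eventually true or eventually false.
    If true, fixing [u = u0] and taking [v = k.+1 + u0 ^ N] gives points [x_ k]
    that contradict the hypothesis on sequences; if false, [v = u ^ N] gives the
    bound. *)
Lemma residual_gt_power (R : realType) (n : nat) (f : 'rV[R]_n -> \bar R)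
    (psi : 'rV[R]_n -> R) (a : R) :
  semialgebraic_fun f -> semialgebraic_fun (fun x => (psi x)%:E) ->
  (forall x, 0 <= psi x) ->
  (forall x_ : nat -> 'rV[R]_n, psi (x_ k) @[k --> \oo] --> (0 : R) ->
     Order.max (a%:E - f (x_ k))%E 0%E @[k --> \oo] --> 0%E) ->
  exists (N : nat) (u0 : R), 1 <= u0 /\
    forall u x r, u0 <= u -> r%:E = f x -> 1 <= u * (a - r) ->
      1 < psi x * u ^+ N.
Proof.
move=> f_sa psi_sa psi_ge0 f_psi.
have [/near_lexP[N [u0 [u0_ge1 D_u]]]|/near_lexP[N [u0 [u0_ge1 D_u]]]] :=
  decided_gap_residual n f psi a f_sa psi_sa.
- have u0_gt0 : 0 < u0 by lra.
  have /choice[x_ x_D] (k : nat) : exists x, exists r, [/\ r%:E = f x,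
      1 <= u0 * (a - r) & psi x * (k.+1%:R + u0 ^+ N) <= 1].
    by apply: (D_u u0); rewrite // lerDr.
  have psi_x0 : psi (x_ k) @[k --> \oo] --> (0 : R).
    apply: (squeeze_cvgr _ (cvg_cst 0) (@cvg_harmonic R)).
    apply: filterE => k; rewrite psi_ge0 /= /harmonic.
    have [r [_ _ psi1]] := x_D k.
    rewrite -[leRHS]mul1r ler_pdivlMr ?ltr0Sn//; apply: le_trans psi1.
    by rewrite mulrDr lerDl mulr_ge0// exprn_ge0// ltW.
  have /(_ _ (nbhs_open_ereal_lt (f := cst u0^-1) _)) := f_psi x_ psi_x0.
  have -> // : 0 < u0^-1 by rewrite invr_gt0.
  move=> /(_ isT) [k _ /(_ k (leqnn k))] /=.
  have [r [<- ar _]] := x_D k.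
  rewrite gt_max => /andP[]; rewrite -EFinB lte_fin /cst => ar_lt _.
  have : u0 * (a - r) < 1 by rewrite -ltr_pdivlMl// mulr1.
  by rewrite ltNge ar.
- exists N, u0; split=> // u x r uu0 rf ar; rewrite ltNge; apply/negP => psi1.
  by apply: (D_u u _ uu0 (lexx _)); exists x, r.
Qed.

(** The hypothesis is used at [u = max (u0, 1 / (a - r))].  The exponent is
    [1 / N.+1] rather than [1 / N] because [N] may be 0. *)
Lemma gap_lt_penalty {R : realType} {N : nat} {u0 a r p c : R} :
  1 <= u0 -> 0 < p ->
  (forall u, u0 <= u -> 1 <= u * (a - r) -> 1 < p * u ^+ N) ->
  (1 + `|a|) * u0 < c ->
  a - r < c * (1 + r ^+ 2) * p `^ N.+1%:R^-1.
Proof.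
move=> u0_ge1 p0 p_gt cc; set alpha : R := N.+1%:R^-1.
have pow0 : 0 < p `^ alpha by rewrite powR_gt0.
have r2 : 0 < 1 + r ^+ 2 by rewrite ltr_wpDr// sqr_ge0.
have c0 : 0 < c by apply: lt_trans cc; rewrite mulr_gt0 ?ltr_wpDr//; lra.
have [ar0|ar0] := leP (a - r) 0.
  by apply: le_lt_trans ar0 _; rewrite !mulr_gt0.
pose u := Num.max u0 (a - r)^-1.
have uu0 : u0 <= u by rewrite le_max lexx.
have uar : 1 <= u * (a - r).
  by rewrite -ler_pdivrMr// mul1r le_max lexx orbT.
have u1 : 1 <= u by lra.
have u_gt0 : 0 < u by lra.
have one_lt : 1 < p `^ alpha * u.
  rewrite ltNge; apply/negP => le1.
  have := p_gt u uu0 uar; rewrite ltNge => /negP; apply.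
  have -> : p = (p `^ alpha) ^+ N.+1.
    by rewrite -powR_mulrn ?powR_ge0// -powRrM mulVf ?pnatr_eq0// powRr1// ltW.
  apply: (@le_trans _ _ ((p `^ alpha * u) ^+ N.+1)); last first.
    by rewrite exprn_ile1// mulr_ge0// ltW.
  rewrite exprMn ler_wpM2l ?exprn_ge0 ?powR_ge0//.
  by rewrite ler_weXn2l.
(* If [u = (a - r)^-1] the left-hand side is 1; if [u = u0], use that [- r] is
   at most [1 + r ^ 2]. *)
have ar_le : (a - r) * u <= (1 + `|a|) * u0 * (1 + r ^+ 2).
  rewrite /u maxr_pMr ?ge_max; last exact: ltW.
  rewrite mulfV ?gt_eqF//.
  have r_le : - r <= 1 + r ^+ 2 by nra.
  have ar2 : 0 <= `|a| * r ^+ 2 by rewrite mulr_ge0// sqr_ge0.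
  have ar1 : a - r <= (1 + `|a|) * (1 + r ^+ 2).
    by have := ler_norm a; rewrite mulrDl mul1r mulrDr mulr1; lra.
  rewrite [(1 + `|a|) * u0]mulrC -mulrA [_ * u0]mulrC ler_wpM2l//; last by lra.
  by apply: mulr_ege1 => //; apply: mulr_ege1; rewrite lerDl// sqr_ge0.
have : (a - r) * u < c * (1 + r ^+ 2) * p `^ alpha * u.
  apply: le_lt_trans ar_le _.
  rewrite -[ltRHS]mulrA.
  apply: (@lt_le_trans _ _ (c * (1 + r ^+ 2))); first by rewrite ltr_pM2r.
  by rewrite ler_peMr// ltW// mulr_gt0.
by rewrite ltr_pM2r.
Qed.

(** * Exactness of the penalization *)

Lemma penalized_on {R : realType} {T : Type} {f : T -> \bar R} {psi : T -> R}
    {c alpha : R} {x : T} :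
  0 < alpha -> psi x = 0 -> penalized f psi c alpha x = f x.
Proof.
by move=> alpha0 psi0; rewrite /penalized psi0 powR0 ?gt_eqF// mule0 adde0.
Qed.

Lemma penalized_off {R : realType} {T : Type} {f : T -> \bar R} {psi : T -> R}
    {a c alpha : R} {x : T} :
  0 < c -> f x != -oo%E -> 0 < psi x ->
  (forall r, r%:E = f x -> a - r < c * (1 + r ^+ 2) * psi x `^ alpha) ->
  (a%:E < penalized f psi c alpha x)%E.
Proof.
move=> c0; rewrite /penalized; case: (f x) => [r| |] // _ psi0 ar.
  by have := ar r erefl; rewrite ltrBlDl -lte_fin.
(* Here [f x = +oo]; the penalty is nonnegative, so the sum is [+oo]. *)
rewrite addye ?ltry//.
rewrite gt_eqF// (lt_le_trans ltNy0)// !mule_ge0 ?lee_fin ?powR_ge0 ?(ltW c0)//.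
by rewrite adde_ge0// sqre_ge0.
Qed.

Theorem theorem5p1 (R : realType) (n : nat) (S : set 'rV[R]_n)
    (f : 'rV[R]_n -> \bar R) (psi : 'rV[R]_n -> R)
    (S_neq0 : S !=set0)
    (S_semialg : semialgebraic S)
    (f_neqNy : forall x, f x != -oo%E)
    (f_semialg : semialgebraic_fun f)
    (finf_fin : ereal_inf (f @` S) \is a fin_num)
    (psi_res : residual_fun S psi)
    (psi_semialg : semialgebraic_fun (fun x => (psi x)%:E))
    (f_psi : forall x_ : nat -> 'rV[R]_n,
        psi (x_ k) @[k --> \oo] --> (0 : R) ->
        Order.max (ereal_inf (f @` S) - f (x_ k))%E 0%E @[k --> \oo]
          --> 0%E) :
  exists cstar alpha : R,
    [/\ 0 < cstar, 0 < alpha <= 1 &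
      forall c : R, cstar < c ->
        ereal_inf (f @` S) = ereal_inf (range (penalized f psi c alpha)) /\
        argmin S f = argmin setT (penalized f psi c alpha)].
Proof.
pose a := fine (ereal_inf (f @` S)).
have aE : ereal_inf (f @` S) = a%:E by rewrite fineK.
have [psi_ge0 psi_eq0] := psi_res.
have [N [u0 [u0_ge1 psi_gt]]] : exists (N : nat) (u0 : R), 1 <= u0 /\
    forall u x r, u0 <= u -> r%:E = f x -> 1 <= u * (a - r) ->
      1 < psi x * u ^+ N.
  by apply: residual_gt_power => // x_ /f_psi; rewrite aE.
pose alpha : R := N.+1%:R^-1.
have alpha0 : 0 < alpha by rewrite invr_gt0 ltr0Sn.
exists ((1 + `|a|) * u0), alpha; split=> //.
- by rewrite mulr_gt0 ?ltr_wpDr//; lra.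
- by rewrite alpha0 invf_le1 ?ltr0Sn// ler1n.
move=> c cc.
have c0 : 0 < c by apply: lt_trans cc; rewrite mulr_gt0 ?ltr_wpDr//; lra.
have penS x : S x -> penalized f psi c alpha x = f x.
  by move=> /psi_eq0; exact: penalized_on.
have penNS x : ~ S x -> (a%:E < penalized f psi c alpha x)%E.
  move=> Sx.
  have psi0 : 0 < psi x by rewrite lt_def psi_ge0 andbT; apply/eqP => /psi_eq0.
  apply: penalized_off => // r rf; apply: gap_lt_penalty cc => // u uu0.
  exact: psi_gt.
have infE : ereal_inf (f @` S) = ereal_inf (range (penalized f psi c alpha)).
  apply/eqP; rewrite eq_le; apply/andP; split.
    apply: le_ereal_inf_tmp => _ [x _ <-].
    have [Sx|Sx] := pselect (S x); last by rewrite aE ltW// penNS.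
    by rewrite penS//; apply: ereal_inf_lbound; exists x.
  apply: le_ereal_inf_tmp => _ [x Sx <-].
  by apply: ereal_inf_lbound; exists x; rewrite ?penS.
split=> //; apply/seteqP; split=> x [].
  by move=> Sx fx fxE; split; rewrite ?penS// fxE infE.
move=> _ px; rewrite -infE => pxE.
have Sx : S x.
  by apply: contrapT => /penNS; rewrite pxE aE ltxx.
by split; rewrite -?(penS _ Sx).
Qed.
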